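(* Let $(G_n)$ be a sequence of simple undirected graphs without isolated vertices, where $G=G_n$ has $n$ vertices, maximum degree $\Delta=\Delta(G_n)$, and $\frac{\Delta}{\mathrm{vol}\, G} = o(n^{-2/3})$ as $n\to\infty$. For each $G=G_n$ let $\lambda_1$ be the second smallest eigenvalue (counted with multiplicity) of the normalized Laplacian $\mathcal{L}$ of $G$, with a corresponding real eigenvector $\mathbf{D}^{1/2}\mathbf{v}$ (so $\mathbf{v}$ is a harmonic eigenvector) satisfying $\|\mathbf{D}^{1/2}\mathbf{v}\|_2 = 1$. Then the Cheeger constant $h_G$ obeys $$\frac{1}{2} - \frac{1-\lambda_1}{2} \;\le\; h_G \;\le\; \left(\frac{1}{2} - \frac{1-\lambda_1}{2\,\|\mathbf{v}\|_\infty^2\, \mathrm{vol}\, G}\right)(1+o(1)),$$ where the $o(1)$ term tends to $0$ as $n\to\infty$.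
   Context: For a graph $G=(V,E)$ (simple, unweighted, undirected, with no isolated vertices), $d_v$ denotes the degree of a vertex $v$, $\mathbf{A}$ the adjacency matrix, $\mathbf{D}$ the diagonal matrix of degrees, and $\mathcal{L} = \mathbf{I} - \mathbf{D}^{-1/2}\mathbf{A}\mathbf{D}^{-1/2}$ the normalized Laplacian, whose eigenvalues in increasing order with multiplicity are $0=\lambda_0\le\lambda_1\le\cdots$. If $\mathbf{D}^{1/2}\mathbf{y}$ is an eigenvector of $\mathcal{L}$, then $\mathbf{y}$ is called a harmonic eigenvector. For $S\subseteq V$, $\mathrm{vol}\, S = \sum_{v\in S} d_v$ and $\mathrm{vol}\, G=\mathrm{vol}\, V$. $E(S,\bar S)$ is the number of edges between $S$ and its complement $\bar S = V\setminus S$. The Cheeger constant is $$h_G = \min_{\substack{S\subset V\\ 0<\mathrm{vol}\, S\le \mathrm{vol}\, G/2}} \frac{E(S,\bar S)}{\mathrm{vol}\, S}.$$ Norms: $\|\mathbf{v}\|_2=\sqrt{\sum_i \mathbf{v}_i^2}$, $\|\mathbf{v}\|_\infty=\max_i|\mathbf{v}_i|$. Asymptotic notation is as the number of vertices $n\to\infty$: $g(n)=o(f(n))$ means $\lim_{n\to\infty} g(n)/f(n)=0$. *)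

(* Defs.v *)
From HB Require Import structures.
From mathcomp Require Import all_boot all_order all_algebra.
From mathcomp Require Import all_classical all_reals all_analysis.
Set Implicit Arguments.
Unset Strict Implicit.
Unset Printing Implicit Defensive.
Import Order.TTheory GRing.Theory Num.Theory.
Local Open Scope ring_scope.

Record sgraph (n : nat) := SGraph {
  adj : rel 'I_n;
  adj_sym : symmetric adj;
  adj_irr : irreflexive adj }.

Definition deg (n : nat) (G : sgraph n) (u : 'I_n) : nat :=
  #|[pred w | adj G u w]|.

Definition no_isolated (n : nat) (G : sgraph n) : Prop :=
  forall u : 'I_n, (0 < deg G u)%N.

Definition maxdeg (n : nat) (G : sgraph n) : nat := (\max_(u < n) deg G u)%N.

Definition vol (n : nat) (G : sgraph n) (S : {set 'I_n}) : nat :=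
  (\sum_(u in S) deg G u)%N.

Definition volG (n : nat) (G : sgraph n) : nat := vol G [set: 'I_n].

(* Each edge between S and its complement is counted once, as the ordered pair
   whose first component lies in S. *)
Definition cut (n : nat) (G : sgraph n) (S : {set 'I_n}) : nat :=
  #|[pred p : 'I_n * 'I_n | [&& p.1 \in S, p.2 \notin S & adj G p.1 p.2]]|.

(* Every ratio is at most 1, because cut G S <= vol G S; so the neutral value 1
   does not affect the minimum as long as some S is admissible, which is the case
   for every graph without isolated vertices on at least two vertices (take S to
   be a vertex of minimum degree). *)
Definition cheeger (R : realType) (n : nat) (G : sgraph n) : R :=
  \big[Num.min/1]_(S : {set 'I_n} |
                   (0 < vol G S)%N && (2 * vol G S <= volG G)%N)
    ((cut G S)%:R / (vol G S)%:R).

Definition adjmx (R : realType) (n : nat) (G : sgraph n) : 'M[R]_n :=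
  \matrix_(i, j) (adj G i j)%:R.

Definition Dsqrt (R : realType) (n : nat) (G : sgraph n) : 'M[R]_n :=
  diag_mx (\row_i Num.sqrt (deg G i)%:R).

Definition Dinvsqrt (R : realType) (n : nat) (G : sgraph n) : 'M[R]_n :=
  diag_mx (\row_i (Num.sqrt (deg G i)%:R)^-1).

Definition normLap (R : realType) (n : nat) (G : sgraph n) : 'M[R]_n :=
  1%:M - Dinvsqrt R G *m adjmx R G *m Dinvsqrt R G.

(* s lists the eigenvalues of M in increasing order, with algebraic multiplicity
   (equal to the geometric one for symmetric M).  Such an s is unique, and it
   exists whenever M is symmetric. *)
Definition spectrum (R : realType) (n : nat) (M : 'M[R]_n) (s : seq R) : Prop :=
  sorted <=%R s /\ char_poly M = \prod_(x <- s) ('X - x%:P).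

Definition second_smallest_eigenvalue (R : realType) (n : nat) (M : 'M[R]_n)
    (a : R) : Prop :=
  exists s : seq R, [/\ spectrum M s, (1 < size s)%N & a = s`_1].

Definition eigenvector (R : realType) (n : nat) (M : 'M[R]_n) (a : R)
    (x : 'cV[R]_n) : Prop :=
  x != 0 /\ M *m x = a *: x.

Definition harmonic_eigenvector (R : realType) (n : nat) (G : sgraph n) (a : R)
    (y : 'cV[R]_n) : Prop :=
  eigenvector (normLap R G) a (Dsqrt R G *m y).

Definition norm2 (R : realType) (n : nat) (x : 'cV[R]_n) : R :=
  Num.sqrt (\sum_(i < n) x i 0 ^+ 2).

Definition norm_inf (R : realType) (n : nat) (x : 'cV[R]_n) : R :=
  \big[Num.max/0]_(i < n) `|x i 0|.

(* Main.v *)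
Require Import Defs.
From HB Require Import structures.
From mathcomp Require Import all_boot all_order all_algebra.
From mathcomp Require Import all_classical all_reals all_analysis.
From mathcomp Require Import all_fingroup complex ring lra zify.
Set Implicit Arguments.
Unset Strict Implicit.
Unset Printing Implicit Defensive.
Import Order.TTheory GRing.Theory Num.Theory.
Import numFieldNormedType.Exports.
Local Open Scope classical_set_scope.
Local Open Scope ring_scope.

(** The lower bound is the easy half of the Cheeger inequality.  For a set [S]
    with at most half of the volume, the vector
    [D^(1/2) (1_S - vol S / vol G)] is orthogonal to the kernel vector
    [D^(1/2) 1] of the Laplacian, and comparing its Rayleigh quotient with
    [lambda1] gives [lambda1 * vol S / 2 <= E(S, ~S)]
    ([cut_ge_second_eigenvalue]).

    The upper bound comes from a random cut.  Put [x = v / |v|_oo] and let each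
    vertex [i] choose independently a sign [sigma_i] with mean [x_i]; let [S] be
    the set of the vertices with sign [+1].
    - The expected cut is [(vol G - x^T A x) / 4], and the eigenvalue equation
      gives [x^T A x = (1 - lambda1) / |v|_oo^2], so it equals [B * vol G / 2],
      where [B] is the bound claimed in the theorem.
    - When [lambda1 <> 0] the vector [x] is orthogonal to the degrees, so the
      imbalance [vol S - vol (~S) = \sum_i d_i sigma_i] has mean zero and
      second moment at most [Delta * vol G].
    - Every [S] satisfies [h (vol G - |vol S - vol (~S)|) <= 2 E(S, ~S)], as the
      smaller side of the cut is a competitor in the minimum defining [h]
      ([cheeger_balance]).

    Taking the expectation of the last inequality yields
    [h (1 - t) <= B] as soon as [Delta / vol G <= t^2] ([cheeger_upper]).  As
    [Delta / vol G] tends to [0], the ratio [h / B] exceeds [1] by at most a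
    vanishing amount, which is the required [o(1)].

    The multiplicative form of the bound demands [h = 0] whenever [B = 0].
    Since [B > 0] for [lambda1 > 0], only [lambda1 = 0] matters: then [0] is a
    double eigenvalue, the kernel contains a vector orthogonal to [D^(1/2) 1],
    and its positive part is a union of connected components
    ([cheeger_disconnected]).

    Both spectral facts, the variational bound and the existence of a second
    eigenvector, require that algebraic and geometric multiplicities of a real
    symmetric matrix agree.  They are obtained by diagonalizing over the complex
    numbers ([real_spectral]). *)

(** * The second eigenvalue of a real symmetric matrix *)

Lemma char_poly_conj (F : fieldType) (n : nat) (P A : 'M[F]_n) :
  P \in unitmx -> char_poly (invmx P *m A *m P) = char_poly A.
Proof.
move=> uP; rewrite /char_poly /char_poly_mx.
have uP' : map_mx polyC P \in unitmx by rewrite map_unitmx.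
have -> : 'X%:M - map_mx polyC (invmx P *m A *m P) =
   map_mx polyC (invmx P) *m ('X%:M - map_mx polyC A) *m map_mx polyC P.
  rewrite !map_mxM mulmxBr mulmxBl; congr (_ - _).
  rewrite -mulmxA -scalar_mxC mulmxA -map_mxM mulVmx // map_mx1.
  by rewrite mul1mx.
rewrite !det_mulmx mulrAC -det_mulmx -map_mxM mulVmx // map_mx1 det1.
by rewrite mul1r.
Qed.

Lemma size_spectrum (R : realType) (n : nat) (M : 'M[R]_n) (s : seq R) :
  spectrum M s -> size s = n.
Proof.
case=> _ cM; have := size_char_poly M; rewrite cM size_prod_XsubC.
by case.
Qed.

Section RealSpectral.

Local Open Scope sesquilinear_scope.

(** The permutation [q] matches the order of the given list of eigenvalues with
    the arbitrary order of the diagonalization; unique factorization of the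
    characteristic polynomial provides it. *)
Lemma real_spectral (R : realType) (n : nat) (M : 'M[R]_n) (s : seq R) :
    M^T = M -> spectrum M s ->
  exists (P : 'M[R[i]]_n) (q : 'S_n), P \is unitarymx /\
    map_mx (real_complex R) M =
      P^t* *m diag_mx (\row_i (real_complex R) s`_(q i)) *m P.
Proof.
move=> Msym [sM cM].
set MC := map_mx _ M.
have MCsym : MC \is symmetricmx.
  apply/is_hermitianmxP; rewrite expr0 scale1r map_mx_id //.
  by rewrite /MC map_trmx Msym.
have MCreal : MC \is a mxOver Num.real.
  apply/mxOverP => i j; rewrite mxE complex_real.
  exact/eqP.
have /hermitian_normalmx/orthomx_spectralP := realsym_hermsym MCsym MCreal.
set P := spectralmx MC; set d := spectral_diag MC => MCE.
have uP : P \is unitarymx := spectral_unitarymx MC.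
have pe : perm_eq [seq real_complex R x | x <- s] [tuple d 0 i | i < n].
  apply: prod_XsubC_eq.
  rewrite big_map.
  have := map_char_poly (real_complex R) M.
  rewrite cM rmorph_prod /= -/MC MCE char_poly_conj ?spectral_unit //.
  rewrite char_poly_trig ?diag_mx_is_trig // => e.
  transitivity (\prod_(i < n) ('X - (diag_mx d i i)%:P)).
    rewrite -e; apply: eq_bigr => x _.
    by rewrite rmorphB /= map_polyX map_polyC.
  rewrite big_map /= big_enum /=; apply: eq_bigr => i _.
  by rewrite mxE eqxx mulr1n.
have ss : size s = n by apply: (@size_spectrum R n M).
have [p pE] := elimT tuple_permP pe.
exists P, (p^-1)%g; split=> //.
rewrite -invmx_unitary // {1}MCE; congr (_ *m diag_mx _ *m _).
apply/rowP => i; rewrite mxE.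
have -> : d 0 i = tnth [tuple d 0 i | i < n] (p ((p^-1)%g i)).
  by rewrite permKV tnth_mktuple.
have := congr1 (fun t : seq R[i] => t`_((p^-1)%g i)) pE.
rewrite (nth_map 0) ?ss // => ->.
by rewrite -tnth_nth !tnth_mktuple.
Qed.

Lemma rank_diag_mx_le (F : fieldType) (n : nat) (d : 'rV[F]_n)
    (A : {set 'I_n}) :
  (forall i, i \in A -> d 0 i = 0) -> (\rank (diag_mx d) <= #|~: A|)%N.
Proof.
move=> dA; rewrite diag_mx_sum_delta (bigID (mem A)) /= big1 ?add0r; last first.
  by move=> i iA; rewrite dA // scale0r.
rewrite -sum1_card.
rewrite [X in (_ <= X)%N](eq_bigl (fun i => i \notin A)); last first.
  by move=> i; rewrite inE.
apply: (big_ind2 (fun (X : 'M[F]_n) k => (\rank X <= k)%N)).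
- by rewrite mxrank0.
- move=> A1 r1 A2 r2 le1 le2.
  exact: leq_trans (mxrank_add _ _) (leq_add le1 le2).
- by move=> i _; rewrite (leq_trans (mxrank_scale _ _)) // mxrank_delta.
Qed.

Section SecondEigenvalue.

Variables (R : realType) (n : nat) (M : 'M[R]_n) (s : seq R).
Hypotheses (Msym : M^T = M) (Ms : spectrum M s) (s_gt1 : (1 < size s)%N).

Let sort_s (i : nat) : (0 < i)%N -> (i < size s)%N -> s`_1 <= s`_i.
Proof.
move=> i0 iS; case: Ms => so _.
by apply: (sorted_leq_nth le_trans lexx) so _ _ _ _ i0; rewrite inE.
Qed.

(** In the coordinates [c] of the diagonalizing basis the form [z M z^T] is
    [\sum_i s_(q i) |c z i|^2], and only the coordinate with [q i = 0] could
    carry a weight below [s`_1].  If [s`_0 < s`_1], then [w] lives on that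
    single coordinate, so orthogonality to [w] makes it vanish in [z]. *)
Lemma second_eigenvalue_le (w z : 'rV[R]_n) :
    w != 0 -> w *m M = s`_0 *: w -> z *m w^T = 0 ->
  s`_1 * (z *m z^T) 0 0 <= (z *m M *m z^T) 0 0.
Proof.
move=> w0 wM zw.
have [P [q [uP MC]]] := real_spectral Msym Ms.
pose f : {rmorphism R -> R[i]} := real_complex R.
pose c (x : 'rV[R]_n) := map_mx f x *m P^t*.
have fJ (x : 'rV[R]_n) : (map_mx f x)^T = P^t* *m (c x)^t*.
  rewrite /c trmx_mul map_mxM trmxCK mulmxA.
  have -> : P^t* *m P = 1%:M.
    by rewrite -invmx_unitary // mulVmx // unitarymx_unit.
  rewrite mul1mx; apply/matrixP => i j; rewrite !mxE.
  by apply/esym/conj_Creal; rewrite complex_real.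
have dotE (x y : 'rV[R]_n) :
    f ((x *m y^T) 0 0) = \sum_i c x 0 i * (c y 0 i)^*.
  have -> : f ((x *m y^T) 0 0) = (map_mx f (x *m y^T)) 0 0 by rewrite [RHS]mxE.
  rewrite map_mxM -map_trmx fJ mulmxA mxE.
  by apply: eq_bigr => i _; rewrite [X in _ * X]mxE [X in _ * (X)^*]mxE.
have qE (x : 'rV[R]_n) :
    f ((x *m M *m x^T) 0 0) = \sum_i f s`_(q i) * (c x 0 i * (c x 0 i)^*).
  have -> : f ((x *m M *m x^T) 0 0) = (map_mx f (x *m M *m x^T)) 0 0.
    by rewrite [RHS]mxE.
  rewrite !map_mxM -map_trmx fJ MC !mulmxA -/(c x).
  rewrite -(mulmxA _ P) (unitarymxP uP) mulmx1.
  rewrite mxE; apply: eq_bigr => i _.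
  rewrite mul_mx_diag mxE (_ : \row_i _ = \row_i f s`_(q i)) //.
  rewrite [in X in _ * X](_ : (c x)^t* i 0 = (c x 0 i)^*); last by rewrite !mxE.
  by rewrite [X in _ * X * _]mxE mulrAC mulrC mulrA.
have c_eigen i : (f s`_(q i) - f s`_0) * c w 0 i = 0.
  have : c (w *m M) 0 i = c (s`_0 *: w) 0 i by rewrite wM.
  rewrite /c map_mxM MC map_mxZ !mulmxA -/(c w).
  rewrite -(mulmxA _ P) (unitarymxP uP) mulmx1 mul_mx_diag -scalemxAl -/(c w).
  rewrite mxE [X in _ * X = _]mxE [RHS]mxE -/f => e.
  by rewrite mulrBl [X in X - _]mulrC e subrr.
have ss := size_spectrum Ms.
have q0 (i : 'I_n) : (q i < size s)%N by rewrite ss.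
rewrite -subr_ge0.
have fle (a : R) : (0 <= f a) = (0 <= a) by rewrite /f lecR.
rewrite -fle rmorphB rmorphM qE dotE mulr_sumr -sumrB.
apply: sumr_ge0 => i _; rewrite -mulrBl.
have [qi0|qi0] := posnP (q i); last first.
  by rewrite mulr_ge0 ?mul_conjC_ge0 // -rmorphB fle subr_ge0 sort_s.
have [-> |ne01] := eqVneq s`_1 s`_0; first by rewrite qi0 subrr mul0r.
suff -> : c z 0 i = 0 by rewrite mul0r mulr0.
have cw0 j : j != i -> c w 0 j = 0.
  move=> ji; have := c_eigen j; move/eqP; rewrite mulf_eq0 -rmorphB.
  case/orP => [|/eqP//]; rewrite fmorph_eq0 subr_eq0 => /eqP e.
  have qj : (0 < q j)%N.
    by rewrite lt0n -qi0; apply: contraNneq ji => /val_inj/perm_inj ->.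
  have := sort_s qj (q0 j); rewrite e => le10.
  have := sort_s (ltnSn 0) s_gt1.
  case: Ms => so _.
  have : s`_0 <= s`_1.
    by apply: (sorted_leq_nth le_trans lexx) so _ _ _ _ _; rewrite ?inE // ltnW.
  by move=> le01; case/negP: ne01; rewrite eq_le le10 le01.
have cwi : c w 0 i != 0.
  apply: contraNneq w0 => cwi.
  have : f ((w *m w^T) 0 0) = 0.
    rewrite dotE big1 // => j _.
    by have [->|/cw0 ->] := eqVneq j i; rewrite ?cwi mul0r.
  move/eqP; rewrite fmorph_eq0 mxE => /eqP e.
  apply/eqP/rowP => j; rewrite mxE.
  have : \sum_j w 0 j ^+ 2 = 0.
    by rewrite -[RHS]e; apply: eq_bigr => k _; rewrite mxE expr2.
  move/psumr_eq0P => /(_ (fun k _ => sqr_ge0 _)) /(_ j isT) /eqP.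
  by rewrite sqrf_eq0 => /eqP.
have : f ((z *m w^T) 0 0) = 0 by rewrite zw mxE rmorph0.
rewrite dotE (bigD1 i) //= big1 ?addr0; last first.
  by move=> j ji; rewrite cw0 // conjC0 mulr0.
by move/eqP; rewrite mulf_eq0 conjC_eq0 (negPf cwi) orbF => /eqP.
Qed.

(** When the two smallest eigenvalues coincide, [M - s`_0] has rank at most
    [n - 2] by [real_spectral], so one more linear condition still
    leaves a nonzero solution. *)
Lemma double_eigenvalue (w : 'rV[R]_n) : s`_0 = s`_1 ->
  exists z : 'rV[R]_n, [/\ z != 0, z *m M = s`_0 *: z & z *m w^T = 0].
Proof.
move=> e01; have ss := size_spectrum Ms.
have [P [q [uP MC]]] := real_spectral Msym Ms.
have n_gt0 : (0 < n)%N by rewrite -ss ltnW.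
have n_gt1 : (1 < n)%N by rewrite -ss.
pose i0 := (q^-1)%g (Ordinal n_gt0); pose i1 := (q^-1)%g (Ordinal n_gt1).
have rkM : (\rank (M - (s`_0)%:M)%R <= n - 2)%N.
  pose d : 'rV[R[i]]_n := \row_i real_complex R (s`_(q i) - s`_0).
  have -> : \rank (M - (s`_0)%:M) = \rank (P^t* *m diag_mx d *m P).
    rewrite -(mxrank_map (real_complex R)) map_mxB MC map_scalar_mx.
    have -> : (real_complex R s`_0)%:M = P^t* *m (real_complex R s`_0)%:M *m P.
      by rewrite -mulmxA mul_scalar_mx -scalemxAr -invmx_unitary //
        mulVmx ?unitarymx_unit // scale_scalar_mx mulr1.
    rewrite -mulmxBl -mulmxBr -diag_const_mx -raddfB.
    congr (\rank (_ *m diag_mx _ *m _)); apply/rowP => i.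
    by rewrite !mxE rmorphB.
  apply: leq_trans (mxrankM_maxl _ _) _.
  apply: leq_trans (mxrankM_maxr _ _) _.
  apply: leq_trans (@rank_diag_mx_le _ _ d [set i0; i1] _) _.
    move=> i; rewrite !inE mxE => /orP[]/eqP ->; rewrite permKV /=.
      by rewrite subrr rmorph0.
    by rewrite e01 subrr rmorph0.
  rewrite cardsCs finset.setCK card_ord cards2 leq_sub2l //.
  by rewrite (_ : i0 != i1) //; apply/negP => /eqP/perm_inj/(congr1 val).
pose B := row_mx (M - (s`_0)%:M) w^T.
have : kermx B != 0.
  rewrite -mxrank_eq0 mxrank_ker -lt0n subn_gt0.
  have : (\rank B <= \rank (M - (s`_0)%:M)%R + \rank (w^T)%R)%N.
    by rewrite -mxrank_tr tr_row_mx -addsmxE (leq_trans (mxrank_adds_leqif _ _))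
      // !mxrank_tr.
  move/leq_ltn_trans; apply.
  apply: (@leq_ltn_trans (n - 2 + 1)); last by rewrite -ltn_subRL; lia.
  by rewrite leq_add // rank_leq_col.
case/rowV0Pn => z /sub_kermxP zB z0; exists z; move: zB.
rewrite mul_mx_row -[0 in RHS]row_mx0 => /eq_row_mx[zM zw]; split=> //.
by apply/eqP; rewrite -subr_eq0 -mul_mx_scalar -mulmxBr zM.
Qed.

End SecondEigenvalue.

End RealSpectral.

(** * Volumes, cuts and the Cheeger constant *)

Section Graph.

Variables (R : realType) (n : nat) (G : sgraph n).

Local Notation a i j := ((adj G i j)%:R : R).
Local Notation d i := ((deg G i)%:R : R).
Local Notation V := ((volG G)%:R : R).
Local Notation h := (cheeger R G).

Definition spin (S : {set 'I_n}) (i : 'I_n) : R := if i \in S then 1 else -1.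

Lemma sum_adj i : \sum_j a i j = d i.
Proof. by rewrite -natr_sum /deg -sum1_card [in RHS]big_mkcond. Qed.

Lemma volE (S : {set 'I_n}) : (vol G S)%:R = \sum_i (i \in S)%:R * d i.
Proof.
rewrite natr_sum big_mkcond; apply: eq_bigr => i _.
by case: (i \in S); rewrite ?mul1r ?mul0r.
Qed.

Lemma volGE : V = \sum_i d i.
Proof. by rewrite volE; apply: eq_bigr => i _; rewrite inE mul1r. Qed.

Lemma spin_vol (S : {set 'I_n}) :
  \sum_i d i * spin S i = 2 * (vol G S)%:R - V.
Proof.
rewrite volE volGE mulr_sumr -sumrB; apply: eq_bigr => i _.
by rewrite /spin; case: (i \in S) => /=; ring.
Qed.

Lemma volC (S : {set 'I_n}) : (vol G S + vol G (~: S))%N = volG G.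
Proof.
rewrite /volG /vol [RHS](bigID (mem S)) /=; congr addn.
  by apply: eq_bigl => i; rewrite !inE.
by apply: eq_bigl => i; rewrite !inE.
Qed.

Lemma cutE (S : {set 'I_n}) : (Defs.cut G S)%:R =
  \sum_i \sum_j a i j * ((i \in S) && (j \notin S))%:R.
Proof.
rewrite /Defs.cut -sum1_card natr_sum pair_big big_mkcond /=.
apply: eq_bigr => -[i j] _; rewrite !inE /=.
by case: (i \in S); case: (j \in S); case: (adj G i j);
  rewrite /= ?mulr1 ?mulr0.
Qed.

Lemma cutC (S : {set 'I_n}) : (Defs.cut G (~: S))%:R = (Defs.cut G S)%:R :> R.
Proof.
rewrite !cutE exchange_big; apply: eq_bigr => i _; apply: eq_bigr => j _.
by rewrite adj_sym !inE negbK andbC.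
Qed.

(** The Dirichlet form of the graph; each edge occurs twice in the sum. *)
Lemma sum_adj_sqrB (f : 'I_n -> R) :
  \sum_i \sum_j a i j * (f i - f j) ^+ 2 =
    2 * (\sum_i d i * f i ^+ 2 - \sum_i \sum_j a i j * (f i * f j)).
Proof.
have e1 : \sum_i \sum_j a i j * f i ^+ 2 = \sum_i d i * f i ^+ 2.
  by apply: eq_bigr => i _; rewrite -mulr_suml sum_adj.
have e2 : \sum_i \sum_j a i j * f j ^+ 2 = \sum_i d i * f i ^+ 2.
  rewrite exchange_big -e1; apply: eq_bigr => i _; apply: eq_bigr => j _.
  by rewrite adj_sym.
rewrite mulrBr mulr_natl mulr2n -{1}e1 -e2 mulr_sumr -big_split -sumrB /=.
apply: eq_bigr => i _; rewrite mulr_sumr -big_split -sumrB /=.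
by apply: eq_bigr => j _; ring.
Qed.

(** The signless form is nonnegative as well, which bounds the eigenvalues of
    the Laplacian by [2]. *)
Lemma sum_adj_sqrD (f : 'I_n -> R) :
  \sum_i \sum_j a i j * (f i + f j) ^+ 2 =
    2 * (\sum_i d i * f i ^+ 2 + \sum_i \sum_j a i j * (f i * f j)).
Proof.
have := sum_adj_sqrB f.
have -> : \sum_i \sum_j a i j * (f i + f j) ^+ 2 =
   \sum_i \sum_j a i j * (f i - f j) ^+ 2 +
   4 * \sum_i \sum_j a i j * (f i * f j).
  rewrite mulr_sumr -big_split; apply: eq_bigr => i _ /=.
  rewrite mulr_sumr -big_split; apply: eq_bigr => j _ /=; ring.
by move=> ->; ring.
Qed.

Lemma cut_sqrB (S : {set 'I_n}) :
  \sum_i \sum_j a i j * ((i \in S)%:R - (j \in S)%:R) ^+ 2 =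
    2 * (Defs.cut G S)%:R.
Proof.
rewrite mulr_natl mulr2n -{2}cutC !cutE -big_split; apply: eq_bigr => i _ /=.
rewrite -big_split; apply: eq_bigr => j _ /=; rewrite !inE.
by case: (i \in S); case: (j \in S) => /=; ring.
Qed.

Lemma cut_spin (S : {set 'I_n}) :
  4 * (Defs.cut G S)%:R = \sum_i \sum_j a i j * (1 - spin S i * spin S j).
Proof.
have -> : 4 * (Defs.cut G S)%:R = 2 * (2 * (Defs.cut G S)%:R) :> R by ring.
rewrite -cut_sqrB mulr_sumr; apply: eq_bigr => i _.
rewrite mulr_sumr; apply: eq_bigr => j _.
by rewrite /spin; case: (i \in S); case: (j \in S) => /=; ring.
Qed.

Lemma cheeger_ge0 : 0 <= h.
Proof. by apply: le_bigmin => // S _; rewrite divr_ge0. Qed.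

Lemma cheeger_vol_cut (S : {set 'I_n}) :
  (2 * vol G S <= volG G)%N -> h * (vol G S)%:R <= (Defs.cut G S)%:R.
Proof.
move=> S2; have [->|S0] := posnP (vol G S); first by rewrite mulr0.
rewrite -ler_pdivlMr ?ltr0n //.
by apply: (@bigmin_le_cond _ _ _ _ S); rewrite S0 S2.
Qed.

(** [vol G - |2 vol S - vol G|] is twice the volume of the smaller of [S] and
    its complement, and both have the same cut.  Unlike the definition of the
    Cheeger constant, this holds for every [S], so it can be averaged over a
    random [S]. *)
Lemma cheeger_balance (S : {set 'I_n}) :
  h * (V - `|2 * (vol G S)%:R - V|) <= 2 * (Defs.cut G S)%:R.
Proof.
have vC : V = (vol G S)%:R + (vol G (~: S))%:R by rewrite -natrD volC.
have [S2|S2] := leqP (2 * vol G S) (volG G).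
  have := cheeger_vol_cut S2.
  have : 2 * (vol G S)%:R - V <= 0 by rewrite subr_le0 -natrM ler_nat.
  by move=> /ler0_norm -> ?; lra.
have := @cheeger_vol_cut (~: S); rewrite cutC.
have -> : (2 * vol G (~: S) <= volG G)%N by move: (volC S) S2; lia.
move=> /(_ isT) hC.
have : 0 <= 2 * (vol G S)%:R - V by rewrite subr_ge0 -natrM ler_nat ltnW.
move=> /ger0_norm ->; rewrite (_ : _ - _ = 2 * (vol G (~: S))%:R).
  by rewrite mulrCA ler_pM2l.
by rewrite vC; ring.
Qed.

End Graph.

(** * Random cuts *)

Section RandomCut.

Variables (R : realType) (n : nat) (x : 'I_n -> R).

(** The probability of [S] when each vertex [i] joins it independently with
    probability [(1 + x i) / 2], that is, when [spin S i] has mean [x i]. *)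
Definition coin_prob (S : {set 'I_n}) : R :=
  \prod_i ((1 + spin R S i * x i) / 2).

(** Independence: products of distinct signs have the product of the means as
    their mean. *)
Lemma coin_prob_moment (B : {set 'I_n}) :
  \sum_S coin_prob S * \prod_(k in B) spin R S k = \prod_(k in B) x k.
Proof.
pose F i : R := (1 + x i) / 2.
pose F' i : R := (if i \in B then -1 else 1) * ((1 - x i) / 2).
transitivity (\prod_i (F i + F' i)); last first.
  rewrite [RHS]big_mkcond; apply: eq_bigr => i _; rewrite /F /F'.
  by case: ifP => _; field.
rewrite bigA_distr; apply: eq_bigr => S _.
rewrite [X in _ * X]big_mkcond -big_split; apply: eq_bigr => i _ /=.
by rewrite /spin /F /F'; case: ifP => _; case: ifP => _; field.
Qed.

Lemma coin_prob_sum : \sum_S coin_prob S = 1.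
Proof.
have := coin_prob_moment finset.set0; rewrite big_set0 => <-.
by apply: eq_bigr => S _; rewrite big_set0 mulr1.
Qed.

Lemma coin_prob_spin2 i j : \sum_S coin_prob S * (spin R S i * spin R S j) =
  if i == j then 1 else x i * x j.
Proof.
have [->|ij] := eqVneq i j.
  rewrite -coin_prob_sum; apply: eq_bigr => S _.
  by rewrite /spin; case: ifP => _; ring.
have := coin_prob_moment [set i; j]%SET.
rewrite big_setU1 ?inE //= big_set1 => <-.
by apply: eq_bigr => S _; rewrite big_setU1 ?inE //= big_set1.
Qed.

Lemma coin_prob_quad (q : 'I_n -> 'I_n -> R) :
  \sum_S coin_prob S * (\sum_i \sum_j q i j * (spin R S i * spin R S j)) =
  \sum_i \sum_j q i j * (if i == j then 1 else x i * x j).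
Proof.
under eq_bigr => S _ do rewrite mulr_sumr.
rewrite exchange_big; apply: eq_bigr => i _ /=.
under eq_bigr => S _ do rewrite mulr_sumr.
rewrite exchange_big; apply: eq_bigr => j _ /=.
rewrite -coin_prob_spin2 mulr_sumr; apply: eq_bigr => S _; ring.
Qed.

(** Off the diagonal the second moment agrees with the square of the mean, which
    vanishes; the diagonal terms contribute at most [c i ^ 2] each. *)
Lemma coin_prob_second_moment (c : 'I_n -> R) : \sum_i c i * x i = 0 ->
  \sum_S coin_prob S * (\sum_i c i * spin R S i) ^+ 2 <= \sum_i c i ^+ 2.
Proof.
move=> cx.
have sqE (y : 'I_n -> R) : (\sum_i c i * y i) ^+ 2 =
    \sum_i \sum_j c i * c j * (y i * y j).
  rewrite expr2 mulr_suml; apply: eq_bigr => i _; rewrite mulr_sumr.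
  by apply: eq_bigr => j _; ring.
under eq_bigr => S _ do rewrite sqE.
rewrite coin_prob_quad.
have -> : \sum_i c i ^+ 2 = \sum_i c i ^+ 2 + (\sum_i c i * x i) ^+ 2.
  by rewrite cx expr0n addr0.
(* The added zero is expanded like the left side, to compare term by term. *)
rewrite sqE -big_split; apply: ler_sum => i _ /=.
rewrite (bigD1 i) //= eqxx mulr1 [in leRHS](bigD1 i) //= -expr2 lerD2l.
rewrite -[leLHS]add0r lerD //.
  by rewrite -!expr2 mulr_ge0 ?sqr_ge0.
by apply: ler_sum => j ji; rewrite eq_sym (negPf ji).
Qed.

Hypothesis x_le1 : forall i, `|x i| <= 1.

Lemma coin_prob_ge0 S : 0 <= coin_prob S.
Proof.
apply: prodr_ge0 => i _; have := x_le1 i; rewrite ler_norml => /andP[? ?].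
by rewrite /spin; case: ifP => _; lra.
Qed.

End RandomCut.

Section UpperBound.

Variables (R : realType) (n : nat) (G : sgraph n).

Local Notation a i j := ((adj G i j)%:R : R).
Local Notation d i := ((deg G i)%:R : R).
Local Notation V := ((volG G)%:R : R).
Local Notation h := (cheeger R G).

Lemma sum_deg_sqr : \sum_i d i ^+ 2 <= (maxdeg G)%:R * V.
Proof.
rewrite volGE mulr_sumr; apply: ler_sum => i _.
by rewrite expr2 ler_wpM2r // ler_nat /maxdeg (bigD1 i) //= leq_maxl.
Qed.

(** The expectation of [cheeger_balance].  With [Y] the imbalance
    [\sum_i d_i sigma_i], the mean of [|Y|] is bounded through
    [|Y| <= (Y^2 / T + T) / 2] with [T = t * vol G], which replaces
    Cauchy-Schwarz. *)
Lemma cheeger_random (x : 'I_n -> R) (t : R) :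
    0 < V -> (forall i, `|x i| <= 1) -> \sum_i d i * x i = 0 ->
    0 < t -> (maxdeg G)%:R <= t ^+ 2 * V ->
  h * (1 - t) * V <= (V - \sum_i \sum_j a i j * (x i * x j)) / 2.
Proof.
move=> V0 x1 dx t0 Dt.
pose Y S : R := \sum_i d i * spin R S i.
have YV S : `|Y S| <= (Y S ^+ 2 / (t * V) + t * V) / 2.
  have tV : 0 < t * V by rewrite mulr_gt0.
  have := sqr_ge0 (`|Y S| - t * V).
  rewrite sqrrB real_normK ?num_real // => sq.
  rewrite -(@ler_pM2r _ (2 * (t * V))) ?mulr_gt0 //.
  have -> : (Y S ^+ 2 / (t * V) + t * V) / 2 * (2 * (t * V)) =
     Y S ^+ 2 + (t * V) ^+ 2 by field; rewrite !gt_eqF.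
  by move: sq; rewrite -mulr_natl; nra.
have wS S : coin_prob x S * (h * (V - (Y S ^+ 2 / (t * V) + t * V) / 2)) <=
    coin_prob x S * (2 * (Defs.cut G S)%:R).
  rewrite ler_wpM2l ?coin_prob_ge0 //.
  apply: le_trans (cheeger_balance R G S).
  rewrite ler_wpM2l ?cheeger_ge0 // -spin_vol lerD2l lerN2; exact: YV.
have cutS : \sum_S coin_prob x S * (2 * (Defs.cut G S)%:R) =
    (V - \sum_i \sum_j a i j * (x i * x j)) / 2.
  transitivity (\sum_S (coin_prob x S * V - coin_prob x S *
      \sum_i \sum_j a i j * (spin R S i * spin R S j)) / 2).
    apply: eq_bigr => S _; rewrite -mulrBr -mulrA; congr (_ * _).
    have -> : 2 * (Defs.cut G S)%:R = 4 * (Defs.cut G S)%:R / 2 :> R by field.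
    rewrite cut_spin volGE -sumrB; congr (_ / 2); apply: eq_bigr => i _.
    by rewrite -sum_adj -sumrB; apply: eq_bigr => j _; ring.
  rewrite -mulr_suml sumrB -mulr_suml coin_prob_sum mul1r coin_prob_quad.
  congr ((_ - _) / 2); apply: eq_bigr => i _; apply: eq_bigr => j _.
  by case: eqVneq => [->|//]; rewrite adj_irr !mul0r.
have m2 := le_trans (coin_prob_second_moment dx) sum_deg_sqr.
rewrite -cutS; apply: (le_trans _ (ler_sum _ (fun S _ => wS S))).
under eq_bigr => S _ do rewrite mulrCA.
rewrite -mulr_sumr -mulrA ler_wpM2l ?cheeger_ge0 //.
have -> : \sum_S coin_prob x S * (V - (Y S ^+ 2 / (t * V) + t * V) / 2) =
    V - t * V / 2 - (\sum_S coin_prob x S * Y S ^+ 2) / (2 * (t * V)).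
  transitivity (\sum_S (coin_prob x S * (V - t * V / 2) -
      coin_prob x S * Y S ^+ 2 / (2 * (t * V)))).
    by apply: eq_bigr => S _; field; rewrite !gt_eqF.
  by rewrite sumrB -!mulr_suml coin_prob_sum mul1r.
have : (\sum_S coin_prob x S * Y S ^+ 2) / (2 * (t * V)) <= t * V / 2.
  rewrite ler_pdivrMr ?mulr_gt0 //; apply: (le_trans m2).
  have -> : t * V / 2 * (2 * (t * V)) = t ^+ 2 * V * V by field.
  by rewrite ler_wpM2r.
move=> ?; lra.
Qed.

End UpperBound.

(** * The quadratic form of the normalized Laplacian *)

Section NormalizedLaplacian.

Variables (R : realType) (n : nat) (G : sgraph n).
Hypothesis iso : no_isolated G.

Local Notation a i j := ((adj G i j)%:R : R).
Local Notation d i := ((deg G i)%:R : R).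
Local Notation V := ((volG G)%:R : R).
Local Notation h := (cheeger R G).
Local Notation L := (normLap R G).

Lemma normLapE i j :
  L i j = (i == j)%:R - a i j / (Num.sqrt (d i) * Num.sqrt (d j)).
Proof.
rewrite /normLap /Dinvsqrt mul_mx_diag mul_diag_mx !mxE; congr (_ - _).
by rewrite invfM mulrA [a i j * _]mulrC.
Qed.

Lemma normLap_sym : L^T = L.
Proof.
apply/matrixP => i j; rewrite mxE !normLapE eq_sym adj_sym.
by rewrite (mulrC (Num.sqrt _)).
Qed.

Definition Dhalf (f : 'I_n -> R) : 'rV[R]_n := \row_i (Num.sqrt (d i) * f i).

Lemma sqrt_deg_gt0 i : 0 < Num.sqrt (d i).
Proof. by rewrite sqrtr_gt0 ltr0n iso. Qed.

Lemma sqrt_degK i : Num.sqrt (d i) * Num.sqrt (d i) = d i.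
Proof. by rewrite -expr2 sqr_sqrtr. Qed.

Lemma DhalfK (z : 'rV[R]_n) : Dhalf (fun i => z 0 i / Num.sqrt (d i)) = z.
Proof.
by apply/rowP => i; rewrite mxE mulrCA divff ?mulr1 // gt_eqF ?sqrt_deg_gt0.
Qed.

Lemma Dhalf_dot f g : (Dhalf f *m (Dhalf g)^T) 0 0 = \sum_i d i * (f i * g i).
Proof.
by rewrite mxE; apply: eq_bigr => i _; rewrite !mxE mulrACA sqrt_degK.
Qed.

Lemma Dhalf_normLap f : Dhalf f *m L =
  Dhalf (fun j => f j - (\sum_i a i j * f i) / d j).
Proof.
apply/rowP => j; rewrite !mxE.
transitivity (\sum_i (Dhalf f 0 i * (i == j)%:R -
    a i j * f i / Num.sqrt (d j))).
  apply: eq_bigr => i _; rewrite normLapE mulrBr mxE; congr (_ - _).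
  by field; rewrite !gt_eqF ?sqrt_deg_gt0.
rewrite sumrB (bigD1 j) //= eqxx big1 ?addr0; last first.
  by move=> i /negPf ->; rewrite mulr0.
rewrite !mxE mulr1 mulrBr -mulr_suml; congr (_ - _).
move: (sqrt_degK j) (\sum_i _) => {3}<- X; field.
by rewrite gt_eqF ?sqrt_deg_gt0.
Qed.

(** The Laplacian form of [D^(1/2) f] is the Dirichlet form of [f]. *)
Lemma Dhalf_quad f : (Dhalf f *m L *m (Dhalf f)^T) 0 0 =
  (\sum_i \sum_j a i j * (f i - f j) ^+ 2) / 2.
Proof.
rewrite Dhalf_normLap Dhalf_dot sum_adj_sqrB mulrAC divff // mul1r exchange_big.
rewrite -sumrB; apply: eq_bigr => j _.
rewrite mulrA [d j * (_ - _)]mulrBr mulrCA divff ?mulr1; last first.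
  by rewrite gt_eqF // ltr0n iso.
by rewrite mulrBl mulr_suml expr2 mulrA; congr (_ - _);
  apply: eq_bigr => i _; rewrite mulrA.
Qed.

Lemma Dhalf_quad_ge0 f : 0 <= (Dhalf f *m L *m (Dhalf f)^T) 0 0.
Proof.
rewrite Dhalf_quad divr_ge0 //; apply: sumr_ge0 => i _; apply: sumr_ge0 => j _.
by rewrite mulr_ge0 ?sqr_ge0.
Qed.

Lemma Dhalf1_normLap : Dhalf (fun=> 1) *m L = 0.
Proof.
rewrite Dhalf_normLap; apply/rowP => j; rewrite !mxE.
under eq_bigr => i _ do rewrite mulr1 adj_sym.
by rewrite sum_adj divff ?subrr ?mulr0 // gt_eqF // ltr0n iso.
Qed.

Lemma Dhalf_eq0 f : Dhalf f = 0 -> f =1 (fun=> 0).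
Proof.
move=> /rowP f0 i; have := f0 i; rewrite !mxE => /eqP.
by rewrite mulf_eq0 gt_eqF ?sqrt_deg_gt0 //= => /eqP.
Qed.

Hypothesis n_gt0 : (0 < n)%N.

Lemma Dhalf1_neq0 : Dhalf (fun=> 1) != 0.
Proof.
apply/eqP => /Dhalf_eq0 /(_ (Ordinal n_gt0)) /eqP.
by rewrite oner_eq0.
Qed.

Lemma volG_gt0 : 0 < V.
Proof.
rewrite ltr0n /volG /vol (bigD1 (Ordinal n_gt0)) ?inE //=.
by rewrite addn_gt0 iso.
Qed.

(** The Laplacian is positive semidefinite, so its eigenvalues are nonnegative,
    and it has [D^(1/2) 1] in its kernel. *)
Lemma normLap_spectrum0 (s : seq R) : spectrum L s -> s`_0 = 0.
Proof.
move=> Ls; have ss := size_spectrum Ls; case: Ls => so cL.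
have rootE x : eigenvalue L x = (x \in s).
  by rewrite eigenvalue_root_char cL root_prod_XsubC.
apply/eqP; rewrite eq_le; apply/andP; split.
  have s0 : 0 \in s.
    rewrite -rootE; apply/eigenvalueP; exists (Dhalf (fun=> 1)).
      by rewrite scale0r Dhalf1_normLap.
    exact: Dhalf1_neq0.
  have i0 : (index 0%R s < size s)%N by rewrite index_mem.
  rewrite -[X in _ <= X](nth_index 0 s0).
  by apply: (sorted_leq_nth le_trans lexx) so _ _ _ _ _;
    rewrite ?inE // (leq_ltn_trans _ i0).
have : s`_0 \in s by rewrite mem_nth // ss.
rewrite -rootE => /eigenvalueP[z zL z0].
(* The form [z L z^T = s`_0 |z|^2] is nonnegative, and [|z|^2 > 0]. *)
have := Dhalf_quad_ge0 (fun i => z 0 i / Num.sqrt (d i)).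
rewrite DhalfK zL -scalemxAl mxE pmulr_lge0 //.
rewrite -{1 2}[z]DhalfK Dhalf_dot.
have p i : 0 <= d i * (z 0 i / Num.sqrt (d i) * (z 0 i / Num.sqrt (d i))).
  by rewrite mulr_ge0 // -expr2 sqr_ge0.
rewrite lt0r sumr_ge0 // andbT psumr_eq0 //; apply: contra z0 => /allP z0.
apply/eqP/rowP => i; rewrite mxE.
have := z0 i; rewrite mem_index_enum => /(_ isT).
rewrite !mulf_eq0 invr_eq0 orbb gt_eqF ?ltr0n ?iso //.
by rewrite (gt_eqF (sqrt_deg_gt0 i)) orbF => /eqP.
Qed.

(** The test vector is [D^(1/2) f] with [f = 1_S - c], [c = vol S / vol G]: its
    Dirichlet form is the cut, and its squared norm [vol S * (1 - c)] is at
    least [vol S / 2]. *)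
Lemma cut_ge_second_eigenvalue (s : seq R) (S : {set 'I_n}) :
    spectrum L s -> (1 < size s)%N -> 0 <= s`_1 ->
    (2 * vol G S <= volG G)%N ->
  s`_1 * (vol G S)%:R / 2 <= (Defs.cut G S)%:R.
Proof.
move=> Ls s1 l0 S2; have V0 := volG_gt0.
pose c : R := (vol G S)%:R / V.
pose f i : R := (i \in S)%:R - c.
have cV : c * V = (vol G S)%:R by rewrite /c divfK ?gt_eqF.
have c2 : c <= 1 / 2.
  by rewrite ler_pdivrMr // mul1r ler_pdivlMl // -natrM ler_nat.
have orth : Dhalf f *m (Dhalf (fun=> 1))^T = 0.
  apply/matrixP => i j; rewrite !ord1 Dhalf_dot mxE.
  under eq_bigr => k _ do rewrite mulr1 /f mulrBr mulrC.
  by rewrite sumrB -volE -mulr_suml -volGE mulrC cV subrr.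
have e0 : Dhalf (fun=> 1) *m L = s`_0 *: Dhalf (fun=> 1).
  by rewrite (normLap_spectrum0 Ls) scale0r Dhalf1_normLap.
have := second_eigenvalue_le normLap_sym Ls s1 Dhalf1_neq0 e0 orth.
rewrite Dhalf_quad Dhalf_dot.
have -> : \sum_i \sum_j a i j * (f i - f j) ^+ 2 = 2 * (Defs.cut G S)%:R.
  rewrite -cut_sqrB; apply: eq_bigr => i _; apply: eq_bigr => j _.
  by rewrite /f; congr (_ * _ ^+ 2); ring.
rewrite [2 * _ / 2]mulrAC divff // mul1r; apply: le_trans.
rewrite -mulrA ler_wpM2l //.
have -> : \sum_i d i * (f i * f i) = (vol G S)%:R * (1 - c).
  transitivity (\sum_i ((i \in S)%:R * d i * (1 - 2 * c) + d i * c ^+ 2)).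
    by apply: eq_bigr => i _; rewrite /f; case: (i \in S) => /=; ring.
  by rewrite big_split -!mulr_suml /= -volE -volGE -cV; ring.
by rewrite ler_wpM2l //; lra.
Qed.

(** A kernel vector [D^(1/2) f] has [f] constant along edges.  Orthogonality to
    the degrees forces [f] to take both a positive and a nonpositive value, so
    [f > 0] cuts the graph into two nonempty parts without crossing edges. *)
Lemma cheeger_disconnected (s : seq R) :
  spectrum L s -> (1 < size s)%N -> s`_1 = 0 -> h = 0.
Proof.
move=> Ls s1 s10; have s00 := normLap_spectrum0 Ls.
have [|z [z0 zL zo]] := double_eigenvalue normLap_sym Ls s1 (Dhalf (fun=> 1)).
  by rewrite s10.
pose f i := z 0 i / Num.sqrt (d i).
have zE : Dhalf f = z := DhalfK z.
rewrite -zE s00 scale0r in zL; rewrite -zE in zo z0.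
have fo : \sum_i d i * f i = 0.
  have /matrixP/(_ 0 0) := zo; rewrite Dhalf_dot mxE; apply: etrans.
  by apply: eq_bigr => i _; rewrite mulr1.
have fa i j : adj G i j -> f i = f j.
  move=> ij; have := Dhalf_quad f; rewrite zL mul0mx mxE => /esym/eqP.
  rewrite mulf_eq0 invr_eq0 pnatr_eq0 orbF psumr_eq0; last first.
    by move=> k _; apply: sumr_ge0 => l _; rewrite mulr_ge0 ?sqr_ge0.
  move/allP/(_ i); rewrite mem_index_enum => /(_ isT).
  rewrite psumr_eq0; last by move=> l _; rewrite mulr_ge0 ?sqr_ge0.
  move/allP/(_ j); rewrite mem_index_enum => /(_ isT).
  by rewrite ij mul1r sqrf_eq0 subr_eq0 => /eqP.
pose S := [set i | 0 < f i]%SET.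
have cut0 : (Defs.cut G S)%:R = 0 :> R.
  rewrite cutE big1 // => i _; rewrite big1 // => j _; rewrite !inE.
  case ij: (adj G i j); last by rewrite mul0r.
  by rewrite (fa _ _ ij) andbN mulr0.
have d0 i : 0 < d i by rewrite ltr0n iso.
have posf : exists i, 0 < f i.
  apply/existsP; apply: contraNT z0 => /existsPn fn.
  have fn' i : f i <= 0 by rewrite leNgt fn.
  apply/eqP/rowP => i; rewrite !mxE.
  suff -> : f i = 0 by rewrite mulr0.
  have : \sum_i d i * (- f i) = 0.
    by under eq_bigr => k _ do rewrite mulrN; rewrite sumrN fo oppr0.
  move/eqP; rewrite psumr_eq0; last first.
    by move=> k _; rewrite mulr_ge0 // oppr_ge0.
  move/allP/(_ i); rewrite mem_index_enum => /(_ isT).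
  by rewrite mulf_eq0 gt_eqF //= oppr_eq0 => /eqP.
have [i fi] := posf.
have [j fj] : exists j, f j <= 0.
  apply/existsP; rewrite -[X in is_true X]negbK; apply/negP => /existsPn fp.
  have fp' k : 0 < f k by rewrite ltNge fp.
  have : 0 < \sum_i d i * f i.
    rewrite (bigD1 i) //= ltr_pwDl ?(mulr_gt0 (d0 i) fi) //.
    by apply: sumr_ge0 => k _; rewrite mulr_ge0 // ltW.
  by rewrite fo ltxx.
have volS : 0 < (vol G S)%:R :> R.
  rewrite ltr0n /vol (bigD1 i) ?inE //= addn_gt0 iso //.
have volCS : 0 < (vol G (~: S))%:R :> R.
  rewrite ltr0n /vol (bigD1 j) ?inE -?leNgt //= addn_gt0 iso //.
have := cheeger_balance R G S; rewrite cut0 mulr0.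
rewrite pmulr_lle0; last first.
  rewrite subr_gt0 -(volC G S) natrD ltr_norml; apply/andP; split; lra.
by move=> hle; apply/eqP; rewrite eq_le hle cheeger_ge0.
Qed.

End NormalizedLaplacian.

(** * Harmonic eigenvectors *)

Section HarmonicEigenvector.

Variables (R : realType) (n : nat) (G : sgraph n) (l : R) (v : 'cV[R]_n).
Hypotheses (iso : no_isolated G) (n_gt0 : (0 < n)%N).
Hypotheses (harm : harmonic_eigenvector G l v).
Hypotheses (nv : norm2 (Dsqrt R G *m v) = 1).

Local Notation a i j := ((adj G i j)%:R : R).
Local Notation d i := ((deg G i)%:R : R).
Local Notation V := ((volG G)%:R : R).
Local Notation h := (cheeger R G).
Local Notation u i := (v i 0).

Lemma harmonic_Dhalf : (Dsqrt R G *m v)^T = Dhalf G (fun i => u i).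
Proof. by apply/rowP => i; rewrite mxE mul_diag_mx !mxE. Qed.

(** The eigenvalue equation multiplied by [D^(1/2)]: [A v = (1 - l) D v]. *)
Lemma harmonicE j : \sum_i a i j * u i = (1 - l) * (d j * u j).
Proof.
have [_ /(congr1 trmx)] := harm.
rewrite trmx_mul normLap_sym linearZ /= harmonic_Dhalf Dhalf_normLap //.
move=> /rowP/(_ j); rewrite !mxE => e.
have w0 := sqrt_deg_gt0 R iso j.
have d0 : d j != 0 by rewrite gt_eqF // ltr0n iso.
have {}e : u j - (\sum_i a i j * u i) / d j = l * u j.
  by apply: (mulfI (lt0r_neq0 w0)); rewrite e mulrCA.
apply: (mulIf (invr_neq0 d0)).
have -> : (1 - l) * (d j * u j) / d j = u j - l * u j by field.
by rewrite -e subKr.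
Qed.

Lemma harmonic_norm : \sum_i d i * u i ^+ 2 = 1.
Proof.
have : norm2 (Dsqrt R G *m v) ^+ 2 = 1 by rewrite nv expr1n.
rewrite /norm2 sqr_sqrtr; last by apply: sumr_ge0 => i _; rewrite sqr_ge0.
apply: etrans; apply: eq_bigr => i _.
by rewrite mul_diag_mx !mxE exprMn sqr_sqrtr.
Qed.

Lemma harmonic_adj : \sum_i \sum_j a i j * (u i * u j) = 1 - l.
Proof.
rewrite -[RHS]mulr1 -[X in _ = _ * X]harmonic_norm mulr_sumr exchange_big.
apply: eq_bigr => j _ /=.
transitivity ((\sum_i a i j * u i) * u j).
  by rewrite mulr_suml; apply: eq_bigr => i _; ring.
by rewrite harmonicE; ring.
Qed.

Lemma harmonic_ge0 : 0 <= l.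
Proof.
have : 0 <= \sum_i \sum_j a i j * (u i - u j) ^+ 2.
  by apply: sumr_ge0 => i _; apply: sumr_ge0 => j _; rewrite mulr_ge0 ?sqr_ge0.
by rewrite sum_adj_sqrB harmonic_norm harmonic_adj => ?; lra.
Qed.

Lemma harmonic_le2 : l <= 2.
Proof.
have : 0 <= \sum_i \sum_j a i j * (u i + u j) ^+ 2.
  by apply: sumr_ge0 => i _; apply: sumr_ge0 => j _; rewrite mulr_ge0 ?sqr_ge0.
by rewrite sum_adj_sqrD harmonic_norm harmonic_adj => ?; lra.
Qed.

(** Sum [A v = (1 - l) D v] over all vertices; the left side sums to
    [\sum_j d_j v_j] as well. *)
Lemma harmonic_mean0 : l != 0 -> \sum_i d i * u i = 0.
Proof.
move=> l0; apply: (mulfI l0); rewrite mulr0.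
have : \sum_j \sum_i a i j * u i = (1 - l) * \sum_j d j * u j.
  by rewrite mulr_sumr; apply: eq_bigr => j _; exact: harmonicE.
rewrite exchange_big /=.
have -> : \sum_i \sum_j a i j * u i = \sum_j d j * u j.
  by apply: eq_bigr => i _; rewrite -mulr_suml sum_adj.
by move=> e; rewrite -{1}[l](subKr 1) mulrBl -e mul1r subrr.
Qed.

Local Notation N := (norm_inf v).

Lemma le_norm_inf i : `|u i| <= N.
Proof. exact: (le_bigmax _ (fun i => `|u i|)). Qed.

(** Since [v] has entries at most [N] in absolute value, this follows from its
    normalization; it makes the upper bound on the Cheeger constant nonnegative,
    and positive when [l] is not zero. *)
Lemma norm_inf_vol : 1 <= N ^+ 2 * V.
Proof.
rewrite -[leLHS]harmonic_norm volGE mulr_sumr; apply: ler_sum => i _.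
rewrite mulrC ler_wpM2r // -real_normK ?num_real //.
by rewrite lerXn2r ?nnegrE ?le_norm_inf // (le_trans _ (le_norm_inf i)).
Qed.

Lemma norm_inf_gt0 : 0 < N.
Proof.
rewrite lt0r (le_trans _ (le_norm_inf (Ordinal n_gt0))) // andbT.
apply/eqP => N0; have := norm_inf_vol.
by rewrite N0 expr0n mul0r ler10.
Qed.

Local Notation B := (1 / 2 - (1 - l) / (2 * N ^+ 2 * V)).

Lemma bound_ge0 : 0 <= B.
Proof.
rewrite subr_ge0 ler_pdivrMr; last first.
  by rewrite !mulr_gt0 ?exprn_gt0 ?norm_inf_gt0 ?volG_gt0.
by move: norm_inf_vol harmonic_ge0 => ? ?; lra.
Qed.

Lemma bound_gt0 : l != 0 -> 0 < B.
Proof.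
move=> l0; have lp : 0 < l by rewrite lt0r l0 harmonic_ge0.
rewrite subr_gt0 ltr_pdivrMr; last first.
  by rewrite !mulr_gt0 ?exprn_gt0 ?norm_inf_gt0 ?volG_gt0.
by move: norm_inf_vol => ?; lra.
Qed.

Lemma cheeger_upper t : l != 0 -> 0 < t ->
  (maxdeg G)%:R <= t ^+ 2 * V -> h * (1 - t) <= B.
Proof.
move=> l0 t0 Dt; have V0 := volG_gt0 R iso n_gt0.
have N0 := norm_inf_gt0.
have x1 i : `|u i / N| <= 1.
  by rewrite normrM normfV (gtr0_norm N0) ler_pdivrMr // mul1r le_norm_inf.
have dx : \sum_i d i * (u i / N) = 0.
  under eq_bigr => i _ do rewrite mulrA.
  by rewrite -mulr_suml harmonic_mean0 ?mul0r.
have := cheeger_random V0 x1 dx t0 Dt.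
have -> : \sum_i \sum_j a i j * (u i / N * (u j / N)) = (1 - l) / N ^+ 2.
  rewrite -harmonic_adj mulr_suml; apply: eq_bigr => i _.
  rewrite mulr_suml; apply: eq_bigr => j _; field.
  by rewrite gt_eqF.
rewrite -ler_pdivlMr // => /le_trans; apply.
rewrite le_eqVlt; apply/orP; left; apply/eqP; field.
by rewrite !gt_eqF.
Qed.

Hypothesis second : second_smallest_eigenvalue (normLap R G) l.

Lemma cheeger_lower : 1 / 2 - (1 - l) / 2 <= h.
Proof.
have [s [Ls s1 lE]] := second.
apply: le_bigmin => [|S /andP[S0 S2]].
  by have := harmonic_le2 => ?; lra.
rewrite ler_pdivlMr ?ltr0n //.
have l0 := harmonic_ge0; rewrite lE in l0.
have := cut_ge_second_eigenvalue iso n_gt0 Ls s1 l0 S2; rewrite -lE.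
by apply: le_trans; rewrite le_eqVlt; apply/orP; left; apply/eqP; field.
Qed.

Lemma cheeger_eq0 : l = 0 -> h = 0.
Proof.
have [s [Ls s1 lE]] := second.
by rewrite lE; apply: (cheeger_disconnected iso n_gt0 Ls).
Qed.

End HarmonicEigenvector.

(** * Asymptotics *)

Theorem theorem2 (R : realType) (G : forall n : nat, sgraph n)
    (lambda1 : nat -> R) (v : forall n : nat, 'cV[R]_n)
    (Giso : forall n : nat, (2 <= n)%N -> no_isolated (G n))
    (Gdelta : (fun n : nat =>
        ((maxdeg (G n))%:R / (volG (G n))%:R) / (n%:R `^ (- (2 / 3))) : R)
      @ \oo --> (0 : R))
    (Glambda : forall n : nat, (2 <= n)%N ->
      second_smallest_eigenvalue (normLap R (G n)) (lambda1 n))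
    (Gv : forall n : nat, (2 <= n)%N ->
      harmonic_eigenvector (G n) (lambda1 n) (v n))
    (Gnorm : forall n : nat, (2 <= n)%N -> norm2 (Dsqrt R (G n) *m v n) = 1) :
  exists eps : nat -> R,
    eps @ \oo --> (0 : R) /\
    forall n : nat, (2 <= n)%N ->
      1 / 2 - (1 - lambda1 n) / 2 <= cheeger R (G n) /\
      cheeger R (G n) <=
        (1 / 2 - (1 - lambda1 n) / (2 * norm_inf (v n) ^+ 2 * (volG (G n))%:R))
        * (1 + eps n).
Proof.
pose h n := cheeger R (G n).
pose B n : R :=
  1 / 2 - (1 - lambda1 n) / (2 * norm_inf (v n) ^+ 2 * (volG (G n))%:R).
(* When [lambda1 n = 0] the bound [B n] may vanish, but so does the Cheeger
   constant, and no correction is needed. *)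
pose eps n : R := if lambda1 n == 0 then 0 else Num.max 0 (h n / B n - 1).
have n0 n : (2 <= n)%N -> (0 < n)%N by case: n.
exists eps; split; last first.
  move=> n n2; split.
    exact: (cheeger_lower (Giso _ n2) (n0 _ n2) (Gv _ n2) (Gnorm _ n2)
      (Glambda _ n2)).
  rewrite -/(h n) -/(B n) /eps; case: eqVneq => [l0|l0].
    rewrite addr0 mulr1 /h.
    rewrite (cheeger_eq0 (Giso _ n2) (n0 _ n2) (Glambda _ n2) l0).
    exact: (bound_ge0 (Giso _ n2) (n0 _ n2) (Gv _ n2) (Gnorm _ n2)).
  have B0 : 0 < B n.
    exact: (bound_gt0 (Giso _ n2) (n0 _ n2) (Gv _ n2) (Gnorm _ n2) l0).
  rewrite mulrC -ler_pdivrMr // -lerBlDl le_max lexx orbT //.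
apply/cvgrPdist_le => e e0.
(* With [t <= 1/2], [1 / (1 - t) <= 1 + 2 t], so the error is at most [2 t]. *)
pose t : R := Num.min (e / 2) (1 / 2).
have t0 : 0 < t by rewrite lt_min !divr_gt0.
have te : 2 * t <= e.
  by have : t <= e / 2 by [rewrite ge_min lexx] => ?; lra.
have t2 : t <= 1 / 2 by rewrite ge_min lexx orbT.
have t20 : 0 < t ^+ 2 by rewrite exprn_gt0.
move/cvgrPdist_le: Gdelta => /(_ _ t20) near_r.
near=> n.
have n2 : (2 <= n)%N by near: n; exists 2.
have : `|0 - (maxdeg (G n))%:R / (volG (G n))%:R / n%:R `^ (- (2 / 3))|
    <= t ^+ 2.
  by near: n.
rewrite sub0r normrN.
have V0 := volG_gt0 R (Giso _ n2) (n0 _ n2).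
have np : 0 < n%:R `^ (- (2 / 3)) :> R by rewrite powR_gt0 // ltr0n n0.
(* As [n^(-2/3) <= 1], the hypothesis yields [Delta / vol G <= t ^ 2]. *)
have np1 : n%:R `^ (- (2 / 3)) <= 1 :> R.
  rewrite powRN invf_le1 ?powR_gt0 ?ltr0n ?n0 //.
  by rewrite -[leLHS](powRr0 n%:R) ler_powR ?ler1n ?n0 ?divr_ge0.
rewrite ger0_norm ?divr_ge0 ?(ltW np) // ler_pdivrMr // => rt.
have Dt : (maxdeg (G n))%:R <= t ^+ 2 * (volG (G n))%:R :> R.
  rewrite -ler_pdivrMr //; apply: (le_trans rt).
  by rewrite ler_piMr // ltW.
rewrite sub0r normrN /eps; case: eqVneq => [_|l0]; first by rewrite normr0 ltW.
rewrite ger0_norm ?le_max ?lexx // ge_max (ltW e0) /=.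
have B0 : 0 < B n.
  exact: (bound_gt0 (Giso _ n2) (n0 _ n2) (Gv _ n2) (Gnorm _ n2) l0).
have hB : h n * (1 - t) <= B n.
  exact: (cheeger_upper (Giso _ n2) (n0 _ n2) (Gv _ n2) (Gnorm _ n2) l0 t0 Dt).
apply: le_trans te; rewrite lerBlDl ler_pdivrMr //.
have h0 : 0 <= h n := cheeger_ge0 R (G n).
have q : 1 <= (1 - t) * (1 + 2 * t) by nra.
have hq : h n <= h n * ((1 - t) * (1 + 2 * t)) by rewrite ler_peMr.
apply: (le_trans hq); rewrite mulrA mulrC ler_wpM2l //; lra.
Unshelve. all: by end_near.
Qed.
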